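(* Let $r\ge 2$ and let $\psi$ be a real-valued function on $[1,\infty)$ (or on a half-line) decreasing to $0$ as $y\to\infty$. Then there exists an uncountable set of vectors $(\alpha_1,\dots,\alpha_r)\in\mathbb{R}^r$, with $1,\alpha_1,\dots,\alpha_r$ linearly independent over $\mathbb{Q}$, such that the corresponding best approximations (in the sense of linear form) satisfy $$\zeta_\nu\le \psi(M_{\nu+r-1})\quad\text{for all }\nu .$$
   Context: For real $\alpha_1,\dots,\alpha_r$ and $m=(m_0,\dots,m_r)\in\mathbb{Z}^{r+1}\setminus\{0\}$ put $\zeta(m)=|m_0+m_1\alpha_1+\dots+m_r\alpha_r|$ and $M=\max_{0\le j\le r}|m_j|$. A point $m\in\mathbb{Z}^{r+1}\setminus\{0\}$ is a best approximation (in the sense of linear form) if $\zeta(m)=\min\{\zeta(n): n\in\mathbb{Z}^{r+1}\setminus\{0\},\ \max_j|n_j|\le M\}$. The best approximations are ordered as $m_1,m_2,\dots$ so that $\zeta_1>\zeta_2>\dots$ and $M_1<M_2<\dots$, where $\zeta_\nu=\zeta(m_\nu)$ and $M_\nu=\max_j|m_{j,\nu}|$. *)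

(* Defs.v *)
From HB Require Import structures.
From mathcomp Require Import all_boot all_order all_algebra.
From mathcomp Require Import all_classical all_reals all_analysis.
Set Implicit Arguments. Unset Strict Implicit. Unset Printing Implicit Defensive.
Import Order.TTheory GRing.Theory Num.Theory.
Import numFieldNormedType.Exports.
Local Open Scope ring_scope.

(* An integer point m = (m_0, m_1, ..., m_r) is a function 'I_r.+1 -> int;
   m_0 is (m ord0), m_j (1 <= j <= r) is (m (lift ord0 j')) with j' : 'I_r. *)

Definition zeta {R : realType} {r : nat} (alpha : 'rV[R]_r) (m : 'I_r.+1 -> int) : R :=
  `| (m ord0)%:~R + \sum_(j < r) (m (lift ord0 j))%:~R * alpha 0 j |.

Definition supnorm {r : nat} (m : 'I_r.+1 -> int) : nat :=
  (\max_(j < r.+1) `|m j|%N)%N.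

Definition nonzero_pt {r : nat} (m : 'I_r.+1 -> int) : Prop := exists j, m j != 0.

Definition best_approx {R : realType} {r : nat} (alpha : 'rV[R]_r) (m : 'I_r.+1 -> int) : Prop :=
  nonzero_pt m /\
  forall n : 'I_r.+1 -> int, nonzero_pt n -> (supnorm n <= supnorm m)%N ->
    zeta alpha m <= zeta alpha n.

(* Mseq enumerates, in strictly increasing order, the values M_1 < M_2 < ...
   of the sup-norms of the best approximations (indexed from 0 here). *)
Definition enum_best_norms {R : realType} {r : nat} (alpha : 'rV[R]_r) (Mseq : nat -> nat) : Prop :=
  (forall k, (Mseq k < Mseq k.+1)%N) /\
  (forall K : nat, (exists m, best_approx alpha m /\ supnorm m = K) <-> exists k, Mseq k = K).

Definition Q_lin_indep_1 {R : realType} {r : nat} (alpha : 'rV[R]_r) : Prop :=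
  forall q : 'I_r.+1 -> rat,
    ratr (q ord0) + \sum_(j < r) ratr (q (lift ord0 j)) * alpha 0 j = 0 ->
    forall j, q j = 0.

(* Main.v *)
(** The numbers [alpha_i] are limits of rationals that are improved one
    coordinate at a time, in cyclic order.  At stage [k] one has a rational point
    [P_k] with coordinates [a_i / q_i], the [q_i] being pairwise coprime; [Q_k] is
    the smallest of them, and sits at coordinate [k mod r].  By coprimality an
    integer form that vanishes at [P_k] has each coefficient divisible by the
    matching [q_i], so every nonzero integer point of norm [< Q_k] has
    [zeta >= 1 / prod q_i] at [P_k].  Stage [k+1] replaces the fraction with
    denominator [Q_k] by a slightly larger one whose denominator is a prime
    exceeding all the [q_i].  If [alpha] is close enough to [P_k], then the form
    [v_k = Q_k x_i - a_i] has norm [Q_k], is smaller at [alpha] than all forms of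
    smaller norm, and is at most [psi (max q_i) = psi (Q_(k+r-1))].  Hence each
    [Q_k] is the norm of a best approximation, so a best approximation with norm
    in [[Q_k, Q_(k+1))] has its [(r-1)]-st successor of norm at most [Q_(k+r-1)].
    Linear independence follows because no nonzero form vanishes at [alpha], and
    since stage [k] may also avoid the [k]-th term of any given sequence, the set
    of such [alpha] is uncountable. *)
Require Import Defs.
From HB Require Import structures.
From mathcomp Require Import all_boot all_order all_algebra.
From mathcomp Require Import all_classical all_reals all_analysis.
From mathcomp Require Import zify lra.
Import Order.TTheory GRing.Theory Num.Theory.
Import numFieldNormedType.Exports.
Local Open Scope ring_scope.
Local Open Scope classical_set_scope.

(** * Integer forms at rational points with coprime denominators *)

Definition ratpt (R : realType) {r : nat} (a q : 'I_r -> nat) : 'rV[R]_r :=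
  \row_i ((a i)%:R / (q i)%:R).

Lemma le_supnorm {r : nat} (n : 'I_r.+1 -> int) j : (`|n j| <= supnorm n)%N.
Proof. exact: (@leq_bigmax _ (absz \o n)). Qed.

Lemma supnorm_gt0 {r : nat} (n : 'I_r.+1 -> int) :
  nonzero_pt n -> (0 < supnorm n)%N.
Proof.
by move=> [j nj0]; apply: leq_trans (le_supnorm n j); rewrite absz_gt0.
Qed.

(** This is the form at [ratpt], cleared of denominators. Modulo [q i] only its [i]-th term
    survives, and there the cofactor of [n (lift ord0 i)] is coprime to [q i]. Vanishing thus kills
    every such coefficient, being smaller than [q i], and then [n ord0]. *)
Lemma ratpt_form_neq0 {r : nat} (a q : 'I_r -> nat) (n : 'I_r.+1 -> int) :
  (forall i, 0 < q i)%N -> (forall i, coprime (a i) (q i)) ->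
  (forall i j, i != j -> coprime (q i) (q j)) ->
  nonzero_pt n -> (forall i, `|n (lift ord0 i)| < q i)%N ->
  n ord0 * (\prod_i q i)%N%:Z +
    \sum_i n (lift ord0 i) * (a i * \prod_(k | k != i) q k)%N%:Z != 0.
Proof.
move=> q0 aq qq [j0 nj0] nq; apply/eqP => z0.
have dvd_prod i k : i != k -> (q i %| \prod_(l | l != k) q l)%N.
  by move=> ik; rewrite (bigD1 i) //= dvdn_mulr.
have nil i : n (lift ord0 i) = 0.
  have: ((q i)%:Z %| n (lift ord0 i) * (a i * \prod_(k | k != i) q k)%N%:Z)%Z.
    move: z0; rewrite [X in _ + X](bigD1 i) //= addrCA => /eqP.
    rewrite addr_eq0 => /eqP ->.
    rewrite rpredN rpredD //.
      by rewrite dvdz_mull // dvdzE /= (bigD1 i) //= dvdn_mulr.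
    apply: rpred_sum => k ki; rewrite dvdz_mull // dvdzE /= dvdn_mull //.
    by rewrite dvd_prod // eq_sym.
  rewrite Gauss_dvdzl; last first.
    rewrite coprimezE !absz_nat coprimeMr [X in X && _]coprime_sym aq /=.
    apply: (big_ind (coprime (q i))) => [|x y qx qy|k ki].
    - exact: coprimen1.
    - by rewrite coprimeMr qx.
    - by rewrite qq // eq_sym.
  rewrite dvdzE /= => qn; apply/eqP; rewrite -absz_eq0; apply/negPn/negP.
  rewrite -lt0n => n0; have := dvdn_leq n0 qn.
  by rewrite leqNgt nq.
have n00 : n ord0 = 0.
  move: z0; rewrite [X in _ + X]big1 ?addr0; last by move=> i _; rewrite nil mul0r.
  move/eqP; rewrite mulf_eq0 => /orP[/eqP//|].
  by rewrite eqz_nat eqn0Ngt prodn_gt0.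
case: (unliftP ord0 j0) nj0 => [i ->|->]; first by rewrite nil eqxx.
by rewrite n00 eqxx.
Qed.

(** Multiplied by the product of the [q i], the form takes a nonzero integer value. *)
Lemma zeta_ratpt_ge (R : realType) {r : nat} (a q : 'I_r -> nat)
    (n : 'I_r.+1 -> int) :
  (forall i, 0 < q i)%N -> (forall i, coprime (a i) (q i)) ->
  (forall i j, i != j -> coprime (q i) (q j)) ->
  nonzero_pt n -> (forall i, `|n (lift ord0 i)| < q i)%N ->
  ((\prod_i q i)%N%:R)^-1 <= zeta (ratpt R a q) n.
Proof.
move=> q0 aq qq n0 nq.
have z0 := ratpt_form_neq0 a q n q0 aq qq n0 nq.
have P0 : 0 < (\prod_i q i)%N%:R :> R by rewrite ltr0n prodn_gt0.
rewrite -div1r ler_pdivrMr // /zeta -[X in _ * X]gtr0_norm // -normrM.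
set z := (X in X != 0) in z0.
rewrite [X in `|X|](_ : _ = z%:~R).
  by rewrite -intr_norm -[1]/(1%:~R) ler_int -gtz0_ge1 normr_gt0.
rewrite /z intrD intrM mulrDl; congr (_ + _).
rewrite mulr_suml raddf_sum /=; apply: eq_bigr => i _.
rewrite intrM -mulrA; congr (_ * _).
rewrite mxE [X in _ * X%:R](bigD1 i) //= -pmulrn !natrM mulrA divfK //.
by rewrite pnatr_eq0 -lt0n.
Qed.

Lemma zeta_perturb (R : realType) {r : nat} (x y : 'rV[R]_r)
    (n : 'I_r.+1 -> int) (K : nat) (e : R) :
  (supnorm n <= K)%N -> (forall i, `|x 0 i - y 0 i| <= e) ->
  zeta y n <= zeta x n + r%:R * (K%:R * e).
Proof.
move=> nK xy; rewrite /zeta -lerBlDl; apply: le_trans (lerB_dist _ _) _.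
rewrite opprD addrACA subrr add0r -sumrB.
apply: le_trans (ler_norm_sum _ _ _) _.
apply: (@le_trans _ _ (\sum_(i < r) K%:R * e)); last first.
  by rewrite sumr_const card_ord [leRHS]mulr_natl.
apply: ler_sum => i _; rewrite -mulrBr normrM distrC ler_pM //.
by rewrite -intr_norm -natr_absz ler_nat (leq_trans (le_supnorm _ _)).
Qed.

(** * Rational points improved one coordinate at a time *)

Definition coord {r : nat} (k : nat) : 'I_r.+1 := inZp k.

Lemma coord_addn (r k : nat) : @coord r (k + r.+1) = coord k.
Proof. by apply: val_inj; rewrite /= modnDr. Qed.

Lemma coord_inj (r k i l : nat) : (i < r.+1)%N -> (l < r.+1)%N ->
  @coord r (k + i) = coord (k + l) -> i = l.
Proof.
move=> ir lr /(congr1 val) /= /eqP; rewrite eqn_modDl !modn_small //.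
by move/eqP.
Qed.

Lemma coord_surj (r k : nat) (x : 'I_r.+1) :
  exists2 i, (i < r.+1)%N & x = coord (k + i).
Proof.
exists ((x + r * k) %% r.+1)%N; first exact: ltn_pmod.
apply: val_inj; rewrite /= modnDmr addnCA -mulSn addnC mulnC modnMDl.
by rewrite modn_small.
Qed.

(* The last clause says that [q] increases along the cyclic order of the
   coordinates starting at [coord k], the next one to be improved. *)
Definition admissible {r : nat} (k : nat) (a q : 'I_r.+1 -> nat) : Prop :=
  [/\ forall i, (a i < q i)%N, forall i, coprime (a i) (q i),
      forall i j, i != j -> coprime (q i) (q j) &
      forall i l, (i < l < r.+1)%N -> (q (coord (k + i)) < q (coord (k + l)))%N].

Lemma coprime_prime_gt (p m : nat) : prime p -> (0 < m < p)%N -> coprime p m.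
Proof. by move=> pp /andP[m0 mp]; rewrite prime_coprime // gtnNdvd. Qed.

(** The denominators are 1 followed by increasing primes. Starting at 1 ensures later that every
    positive norm lies between two consecutive [Q k]. *)
Lemma admissible0 (r : nat) :
  exists a q : 'I_r.+1 -> nat, admissible 0 a q /\ q (coord 0) = 1%N.
Proof.
have [s [s0 sp sS]] : exists s : nat -> nat, [/\ s 0%N = 1%N,
    forall i, prime (s i.+1) & forall i, (s i < s i.+1)%N].
  pose nextp m := s2val (prime_above m).
  exists (fun i => iter i nextp 1%N); split=> // i /=.
    exact: (s2valP' (prime_above _)).
  exact: (s2valP (prime_above _)).
have slt : {homo s : i l / (i < l)%N} by exact: homo_ltn ltn_trans sS.
have spos i : (0 < s i)%N by case: i => [|i]; rewrite ?s0 // prime_gt0.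
have sco i l : (i < l)%N -> coprime (s l) (s i).
  case: l => // l il; apply: coprime_prime_gt => //.
  by rewrite spos slt.
exists (fun i => (i != ord0 :> 'I_r.+1)), (fun i => s i); split=> //.
split.
- move=> i; have [->|i0] := eqVneq i ord0; first by rewrite s0.
  by have := slt 0%N i; rewrite s0 lt0n; apply.
- move=> i; have [->|_] := eqVneq i ord0; first by rewrite s0.
  exact: coprime1n.
- move=> i j; rewrite -val_eqE neq_ltn => /orP[ij|ji]; last exact: sco.
  by rewrite coprime_sym sco.
- move=> i l /andP[il lr]; rewrite !add0n /= !modn_small //.
    exact: slt.
  exact: ltn_trans lr.
Qed.

Lemma admissible_min {r k : nat} {a q : 'I_r.+1 -> nat} :
  admissible k a q -> forall i, (q (coord k) <= q i)%N.
Proof.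
move=> [_ _ _ qlt] x; have [[|i] ir ->] := coord_surj r k x.
  by rewrite addn0.
by rewrite ltnW // -[X in coord X]addn0 qlt.
Qed.

Lemma approx_above (R : realType) (a q p : nat) (e : R) :
  (a < q < p)%N -> p%:R^-1 <= e ->
  exists b, (0 < b < p)%N /\
    (a%:R / q%:R : R) <= b%:R / p%:R <= a%:R / q%:R + e.
Proof.
move=> /andP[aq qp] pe.
have q0 : (0 < q)%N by exact: leq_ltn_trans aq.
have p0 : (0 < p)%N by exact: leq_ltn_trans qp.
have q0R : 0 < q%:R :> R by rewrite ltr0n.
have p0R : 0 < p%:R :> R by rewrite ltr0n.
(* Rounding [a p / q] strictly upwards keeps the numerator positive, hence coprime to [p] once [p]
   is prime; it stays below [p] because [a < q < p]. *)
exists ((a * p) %/ q).+1; have ub := ltn_ceil (a * p) q0.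
have lb := leq_divM (a * p) q.
have dlt : ((a * p) %/ q < p)%N by rewrite ltn_divLR // [(p * q)%N]mulnC ltn_mul2r p0.
split.
  rewrite /= ltn_neqAle dlt andbT; apply/eqP => E.
  move: lb; rewrite -[in X in (_ <= X)%N -> _]E; nia.
apply/andP; split.
  by rewrite ler_pdivlMr // mulrAC ler_pdivrMr // -!natrM ler_nat ltnW.
apply: (@le_trans _ _ (a%:R / q%:R + p%:R^-1)); last by rewrite lerD2l.
rewrite ler_pdivrMr // mulrDl mulVf ?gt_eqF // -natr1 lerD2r.
by rewrite mulrAC ler_pdivlMr // -!natrM ler_nat.
Qed.

Lemma admissible_step (R : realType) (r k : nat) (a q : 'I_r.+1 -> nat) (e : R) :
  0 < e -> admissible k a q ->
  exists a' q' : 'I_r.+1 -> nat,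
    [/\ admissible k.+1 a' q',
        forall i, i != coord k -> a' i = a i /\ q' i = q i &
        forall i, ratpt R a q 0 i <= ratpt R a' q' 0 i <= ratpt R a q 0 i + e].
Proof.
move=> e0 [aq cop qq qlt].
have qpos i : (0 < q i)%N by exact: leq_ltn_trans (aq i).
pose N := (\max_i q i + Num.trunc e^-1)%N.
have [p Np pp] := prime_above N.
have qp i : (q i < p)%N.
  apply: leq_ltn_trans Np; apply: leq_trans (leq_addr _ _).
  exact: (@leq_bigmax _ q).
have pe : p%:R^-1 <= e.
  rewrite invf_ple ?posrE ?ltr0n ?prime_gt0 //.
  apply: ltW; apply: lt_le_trans (truncnS_gt _) _; rewrite ler_nat.
  by apply: leq_trans Np; rewrite ltnS leq_addl.
have [b [bp bE]] : exists b, (0 < b < p)%N /\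
    ((a (coord k))%:R / (q (coord k))%:R : R) <= b%:R / p%:R
      <= (a (coord k))%:R / (q (coord k))%:R + e.
  by apply: approx_above => //; rewrite aq qp.
exists (fun i => if i == coord k then b else a i),
       (fun i => if i == coord k then p else q i).
split; first split.
- by move=> i; case: ifP => // _; case/andP: bp.
- move=> i; case: ifP => // _.
  by rewrite coprime_sym coprime_prime_gt.
- move=> i j ij; case: eqVneq => [ik|ik]; case: eqVneq => [jk|jk].
  + by rewrite ik jk eqxx in ij.
  + by rewrite coprime_prime_gt // qpos qp.
  + by rewrite coprime_sym coprime_prime_gt // qpos qp.
  + exact: qq.
(* Counted from [k.+1], the replaced coordinate comes last, and its denominator [p] exceeds all the
   others. *)
- move=> i l /andP[il lr]; rewrite !addSnnS.
  have -> : (@coord r (k + i.+1) == coord k) = false.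
    apply/eqP => E; have := @coord_inj r k i.+1 0%N; rewrite addn0.
    move/(_ (leq_ltn_trans il lr) isT E) => //.
  case: eqVneq => // lk.
  apply: qlt; rewrite ltnS il /= ltn_neqAle lr andbT.
  by apply/eqP => E; move: lk; rewrite E coord_addn eqxx.
- by move=> i /negPf ->.
- move=> i; rewrite !mxE; case: eqVneq => [->//|_].
  by rewrite lexx lerDl ltW.
Qed.

(** [E] is a tolerance to be chosen later, depending on the current point. The boxes with lower
    corner [ratpt R (a k) (q k)] and side [h k] are nested, so a point common to all of them is
    within tolerance of every stage. *)
Lemma admissible_seq (R : realType) (r : nat)
    (E : nat -> ('I_r.+1 -> nat) -> ('I_r.+1 -> nat) -> R) :
  (forall k a q, admissible k a q -> 0 < E k a q) ->
  exists (a q : nat -> 'I_r.+1 -> nat) (h : nat -> R),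
    [/\ q 0%N (coord 0) = 1%N,
        forall k, admissible k (a k) (q k),
        forall k, 0 < h k <= E k (a k) (q k),
        forall k i, i != coord k -> a k.+1 i = a k i /\ q k.+1 i = q k i &
        forall k i, ratpt R (a k) (q k) 0 i <= ratpt R (a k.+1) (q k.+1) 0 i /\
          ratpt R (a k.+1) (q k.+1) 0 i + h k.+1 <= ratpt R (a k) (q k) 0 i + h k].
Proof.
move=> Epos.
pose T := (('I_r.+1 -> nat) * ('I_r.+1 -> nat) * R)%type.
pose good k (s : T) := admissible k s.1.1 s.1.2 /\ 0 < s.2 <= E k s.1.1 s.1.2.
pose next k (s t : T) :=
  (forall i, i != coord k -> t.1.1 i = s.1.1 i /\ t.1.2 i = s.1.2 i) /\
  (forall i, ratpt R s.1.1 s.1.2 0 i <= ratpt R t.1.1 t.1.2 0 i /\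
    ratpt R t.1.1 t.1.2 0 i + t.2 <= ratpt R s.1.1 s.1.2 0 i + s.2).
(* Goodness is assumed inside the existential so that choice yields a total function. *)
have step (ks : nat * T) :
    exists t, good ks.1 ks.2 -> good ks.1.+1 t /\ next ks.1 ks.2 t.
  case: ks => k [[a q] h] /=.
  have [[adm /andP[/= h0 hE]]|nadm] := pselect (good k (a, q, h)); last first.
    by exists (a, q, h).
  (* One half of [h] bounds the move of the point, the other half the new side. *)
  have h20 : 0 < h / 2 by rewrite divr_gt0.
  have [a' [q' [adm' same close]]] := admissible_step R r k a q _ h20 adm.
  have E'0 := Epos _ _ _ adm'.
  exists (a', q', Num.min (h / 2) (E k.+1 a' q')) => _; split.
    by split=> //=; rewrite lt_min h20 E'0 /= ge_min lexx orbT.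
  split=> //= i; have /andP[lo hi] := close i; split=> //.
  apply: (@le_trans _ _ (ratpt R a q 0 i + h / 2 + h / 2)).
    by apply: lerD => //; rewrite ge_min lexx.
  by rewrite -addrA -splitr.
have [f fP] := choice step.
have [a0 [q0 [adm0 q01]]] := admissible0 r.
pose s := fix s k := if k is k'.+1 then f (k', s k') else (a0, q0, E 0%N a0 q0).
have sgood k : good k (s k).
  elim: k => [|k IH] /=; last by have [] := fP (k, s k) IH.
  by split=> //=; rewrite lexx Epos.
have snext k : next k (s k) (s k.+1) by have [] := fP (k, s k) (sgood k).
exists (fun k => (s k).1.1), (fun k => (s k).1.2), (fun k => (s k).2).
split=> // [k|k|k|k].
- by have [] := sgood k.
- by have [] := sgood k.
- by have [] := snext k.
- by have [] := snext k.
Qed.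

(** * The limit point and its leading forms *)

Lemma nested_intervals (R : realType) (u w : nat -> R) :
  (forall k, u k <= u k.+1) -> (forall k, w k.+1 <= w k) ->
  (forall k, u k <= w k) -> exists x, forall k, u k <= x <= w k.
Proof.
move=> uS wS uw.
have uhomo k l : (k <= l)%N -> u k <= u l.
  exact: (homo_leq lexx le_trans uS).
have whomo k l : (k <= l)%N -> w l <= w k.
  by move/subnK <-; elim: (l - k)%N => [|d IH]; [exact: lexx|exact: le_trans (wS _) IH].
have ul k l : u k <= w l.
  case: (leqP k l) => [kl|/ltnW lk]; first exact: le_trans (uhomo _ _ kl) (uw l).
  exact: le_trans (uw k) (whomo _ _ lk).
exists (sup (range u)) => k; apply/andP; split.
  by apply: ub_le_sup; [exists (w 0%N) => _ [l _ <-]|exists k].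
by apply: ge_sup; [exists (u 0%N), 0%N|move=> _ [l _ <-]].
Qed.

(** The coefficients of the form [q x_i - a]. *)
Definition coordpt {r : nat} (a q : nat) (i : 'I_r) (j : 'I_r.+1) : int :=
  if unlift ord0 j is Some l then (if l == i then q%:Z else 0) else - a%:Z.

Lemma coordptE {r : nat} (a q : nat) (i l : 'I_r) :
  coordpt a q i (lift ord0 l) = if l == i then q%:Z else 0.
Proof. by rewrite /coordpt liftK. Qed.

Lemma coordpt0 {r : nat} (a q : nat) (i : 'I_r) : coordpt a q i ord0 = - a%:Z.
Proof. by rewrite /coordpt unlift_none. Qed.

Lemma supnorm_coordpt {r : nat} (a q : nat) (i : 'I_r) :
  (a <= q)%N -> supnorm (coordpt a q i) = q.
Proof.
move=> aq; apply/eqP; rewrite eqn_leq; apply/andP; split.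
  apply/bigmax_leqP => j _; case: (unliftP ord0 j) => [l ->|->].
    by rewrite coordptE; case: ifP.
  by rewrite coordpt0 abszN.
by apply: leq_trans (le_supnorm _ (lift ord0 i)); rewrite coordptE eqxx.
Qed.

Lemma zeta_coordpt (R : realType) {r : nat} (x : 'rV[R]_r) (a q : nat) (i : 'I_r) :
  (0 < q)%N -> zeta x (coordpt a q i) = q%:R * `|x 0 i - a%:R / q%:R|.
Proof.
move=> q0; have qn0 : q%:R != 0 :> R by rewrite pnatr_eq0 -lt0n.
rewrite /zeta coordpt0 (bigD1 i) //= big1 ?addr0.
  rewrite coordptE eqxx -[X in X * `|_|]ger0_norm // -normrM; congr (`|_|).
  by rewrite mulrBr mulrCA divff // mulr1 rmorphN addrC.
by move=> l /negPf li; rewrite coordptE li mul0r.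
Qed.

(* The dimension is [r.+1], so [Q (k + r)] is the [Q_(k+r-1)] of the informal
   statement; [g] is the sequence to be avoided by the first coordinate. *)
Lemma exists_leading_forms (R : realType) (r : nat) (phi : nat -> R) (g : nat -> R) :
  (0 < r)%N ->
  (forall n, (0 < n)%N -> 0 < phi n) ->
  (forall m n, (0 < m <= n)%N -> phi n <= phi m) ->
  exists (alpha : 'rV[R]_r.+1) (Q : nat -> nat) (v : nat -> 'I_r.+2 -> int),
    [/\ Q 0%N = 1%N, forall k, (Q k < Q k.+1)%N,
        forall k, nonzero_pt (v k) /\ supnorm (v k) = Q k,
        forall k, zeta alpha (v k) <= phi (Q (k + r)%N) /\
          forall n, nonzero_pt n -> (supnorm n < Q k)%N ->
            zeta alpha (v k) < zeta alpha n &
        forall k, (forall a q : nat, g k <> a%:R / q%:R) -> alpha 0 0 <> g k].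
Proof.
move=> r0 phi0 phile.
(* Half the distance keeps [alpha] off [g k]. The value 1 is arbitrary: it occurs only if [g k] is a
   quotient of naturals, which need not be avoided. *)
pose gap k (a q : 'I_r.+1 -> nat) : R :=
  if g k == ratpt R a q 0 0 then 1 else `|g k - ratpt R a q 0 0| / 2.
(* The first bound makes [zeta alpha (v k)] at most [phi] of the largest denominator. In the second,
   [r.+2] counts one [Q k * h k] bounding [zeta alpha (v k)] and [r.+1] more lost by a shorter form
   between the rational point and [alpha]; halving gives strictness. *)
pose E k (a q : 'I_r.+1 -> nat) : R :=
  Num.min (phi (\max_i q i)%N / (q (coord k))%:R)
    (Num.min (((q (coord k))%:R * r.+2%:R * (\prod_i q i)%N%:R)^-1 / 2)
      (gap k a q)).
have gap0 k a q : 0 < gap k a q.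
  rewrite /gap; case: eqVneq => // gP.
  by rewrite divr_gt0 // normr_gt0 subr_eq0.
have qpos k (a q : 'I_r.+1 -> nat) : admissible k a q -> forall i, (0 < q i)%N.
  by move=> [aq _ _ _] i; exact: leq_ltn_trans (aq i).
have Epos k a q : admissible k a q -> 0 < E k a q.
  move=> /qpos q0; rewrite /E !lt_min gap0 andbT; apply/andP; split.
    rewrite divr_gt0 ?ltr0n // phi0 //.
    by apply: leq_trans (q0 ord0) _; exact: (@leq_bigmax _ q).
  by rewrite divr_gt0 // invr_gt0 !mulr_gt0 ?ltr0n ?prodn_gt0.
have [a [q [h [q01 adm hE same nest]]]] := admissible_seq R r E Epos.
have h0 k : 0 < h k by case/andP: (hE k).
have hle k : h k <= E k (a k) (q k) by case/andP: (hE k).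
have [x xP] : exists x : 'I_r.+1 -> R, forall i k,
    ratpt R (a k) (q k) 0 i <= x i <= ratpt R (a k) (q k) 0 i + h k.
  suff /choice[x xP] : forall i, exists x, forall k,
      ratpt R (a k) (q k) 0 i <= x <= ratpt R (a k) (q k) 0 i + h k by exists x.
  move=> i; apply: nested_intervals => k.
  - by have [] := nest k i.
  - by have [] := nest k i.
  - by rewrite lerDl ltW.
pose alpha : 'rV[R]_r.+1 := \row_i x i.
pose Q k := q k (coord k).
pose v k : 'I_r.+2 -> int := coordpt (a k (coord k)) (Q k) (coord k).
have alphaP k i : `|alpha 0 i - ratpt R (a k) (q k) 0 i| <= h k.
  have /andP[lo hi] := xP i k; rewrite mxE ger0_norm ?subr_ge0 //.
  by rewrite lerBlDl.
have Q0 k : (0 < Q k)%N by exact: qpos (adm k) _.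
(* Coordinate [coord (k + i)] is not replaced before stage [k + i], so [q k] already contains [Q k]
   up to [Q (k + r)]. *)
have persist k i : (i <= r)%N -> q k (coord (k + i)) = Q (k + i)%N.
  move=> ir; suff keep l : (l <= i)%N ->
      q k (coord (k + i)) = q (k + l)%N (coord (k + i)).
    exact: keep.
  elim: l => [|l IH] li; first by rewrite addn0.
  rewrite IH 1?ltnW // addnS; have [|_ -> //] := same (k + l)%N (coord (k + i)).
  apply/eqP => E'; have lr : (l < r.+1)%N by rewrite ltnS (leq_trans _ ir) // ltnW.
  by have il := coord_inj r k i l ir lr E'; rewrite il ltnn in li.
have QS k : (Q k < Q k.+1)%N.
  have [_ _ _ qlt] := adm k.
  by have := qlt 0%N 1%N; rewrite !persist // addn0 addn1; exact.
have zv k : zeta alpha (v k) <= (Q k)%:R * h k.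
  rewrite zeta_coordpt // ler_pM2l ?ltr0n //.
  by have := alphaP k (coord k); rewrite [ratpt _ _ _ _ _]mxE.
exists alpha, Q, v; split=> //.
- move=> k; have [aq _ _ _] := adm k; split; last by rewrite supnorm_coordpt // ltnW.
  exists (lift ord0 (coord k)); rewrite /v coordptE eqxx.
  by rewrite eqz_nat -lt0n.
- move=> k; have := hle k; rewrite /E !le_min => /and3P[hphi hprod _]; split.
    apply: le_trans (zv k) _; rewrite mulrC -ler_pdivlMr ?ltr0n //.
    apply: le_trans hphi _; rewrite ler_pM2r ?invr_gt0 ?ltr0n; last exact: Q0.
    by apply: phile; rewrite Q0 -persist //=; exact: (@leq_bigmax _ (q k)).
  move=> n n0 nQ; apply: le_lt_trans (zv k) _.
  have [aq co qq _] := adm k.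
  have P0 : 0 < (\prod_i q k i)%N%:R :> R.
    by rewrite ltr0n prodn_gt0 // => i; exact: qpos (adm k) _.
  have lb : (\prod_i q k i)%N%:R^-1 <= zeta (ratpt R (a k) (q k)) n.
    apply: zeta_ratpt_ge => // [i|i]; first exact: qpos (adm k) _.
    apply: leq_ltn_trans (le_supnorm _ _) (leq_trans nQ _).
    exact: admissible_min (adm k) _.
  have := zeta_perturb _ alpha (ratpt R (a k) (q k)) n (Q k) (h k) (ltnW nQ) (alphaP k).
  move/(le_trans lb) => lb'.
  have QR : 0 < (Q k)%:R :> R by rewrite ltr0n.
  have : (Q k)%:R * r.+2%:R * h k < (\prod_i q k i)%N%:R^-1.
    have c0 : 0 < (Q k)%:R * r.+2%:R :> R by rewrite mulr_gt0 ?ltr0n.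
    apply: (@le_lt_trans _ _ ((\prod_i q k i)%N%:R^-1 / 2)).
      move: hprod; rewrite -/(Q k) invfM => hprod.
      by rewrite mulrC -ler_pdivlMr // mulrAC [_^-1 * _^-1]mulrC.
    by rewrite ltr_pdivrMr // mulr_natr mulr2n ltrDl invr_gt0.
  move=> hlt; have := lt_le_trans hlt lb'; rewrite -(natr1 r.+1); lra.
- move=> k gk xg; have := hle k; rewrite /E !le_min => /and3P[_ _].
  rewrite /gap; case: eqVneq => [E1|gP].
    by case: (gk (a k 0) (q k 0)); rewrite E1 mxE.
  have := alphaP k 0; rewrite xg; set d := `|_| => d1 d2.
  have d0 : 0 < d by rewrite normr_gt0 subr_eq0.
  have := le_trans d1 d2; lra.
Qed.

(** * Existence and enumeration of best approximations *)

(** Shifting coordinates by [K] encodes the box of norm at most [K] in a finite type, where a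
    minimum is attained. *)
Lemma exists_best_le (R : realType) (r : nat) (alpha : 'rV[R]_r) (K : nat) :
  (0 < K)%N ->
  exists m : 'I_r.+1 -> int, [/\ nonzero_pt m, (supnorm m <= K)%N &
    forall n, nonzero_pt n -> (supnorm n <= K)%N -> zeta alpha m <= zeta alpha n].
Proof.
move=> K0; pose T := {ffun 'I_r.+1 -> 'I_(K + K).+1}.
pose dec (f : T) (j : 'I_r.+1) : int := (f j : nat)%:Z - K%:Z.
have decS f : (supnorm (dec f) <= K)%N.
  by apply/bigmax_leqP => j _; rewrite /dec; have := ltn_ord (f j); lia.
have decK n : (supnorm n <= K)%N -> exists f, dec f = n.
  move=> nK; exists [ffun j => inord (absz (n j + K%:Z))].
  apply: funext => j; rewrite /dec ffunE inordK.
    by have := leq_trans (le_supnorm n j) nK; lia.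
  by have := leq_trans (le_supnorm n j) nK; lia.
pose P : pred T := fun f => `[< nonzero_pt (dec f) >].
have [f0 Pf0] : exists f0, P f0.
  have [|f Ef] := decK (fun=> 1) _; first by apply/bigmax_leqP.
  by exists f; apply/asboolP; rewrite Ef; exists ord0.
case: (arg_minP (fun f => zeta alpha (dec f)) Pf0) => f /asboolP Pf fmin.
exists (dec f); split=> // n n0 /decK[f' Ef'].
by rewrite -Ef'; apply: fmin; apply/asboolP; rewrite Ef'.
Qed.

(** Each term is the least element of [B] above the previous one. The last clause, that nothing is
    skipped, serves to compare [s] with [Q]. *)
Lemma enum_unbounded (B : nat -> Prop) :
  (forall N, exists2 n, B n & (N <= n)%N) ->
  exists s : nat -> nat, [/\ forall k, (s k < s k.+1)%N,
    forall K, B K <-> exists k, s k = K &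
    forall k K, B K -> (s k < K)%N -> (s k.+1 <= K)%N].
Proof.
move=> Bunb.
have [nx nxP] : {nx : nat -> nat & forall N, [/\ B (nx N), (N <= nx N)%N &
    forall l, B l -> (N <= l)%N -> (nx N <= l)%N]}.
  apply: (@choice nat nat (fun N n => [/\ B n, (N <= n)%N &
    forall l, B l -> (N <= l)%N -> (n <= l)%N])) => N.
  have ex : exists n, `[< B n >] && (N <= n)%N.
    by have [n Bn Nn] := Bunb N; exists n; rewrite Nn andbT; apply/asboolP.
  case: (ex_minnP ex) => n /andP[/asboolP Bn Nn] nmin; exists n; split=> // l Bl Nl.
  by apply: nmin; rewrite Nl andbT; apply/asboolP.
pose s := fix s k := if k is k'.+1 then nx (s k').+1 else nx 0%N.
have sS k : (s k < s k.+1)%N by have [] := nxP (s k).+1.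
have smin k K : B K -> (s k < K)%N -> (s k.+1 <= K)%N.
  by move=> BK; have [_ _] := nxP (s k).+1; apply.
exists s; split=> // K; split=> [BK|[k <-]]; last first.
  by case: k => [|k]; [have [] := nxP 0%N|have [] := nxP (s k).+1].
have sge k : (k <= s k)%N by elim: k => // k IH; exact: leq_ltn_trans (sS k).
suff: forall k, (K < s k)%N -> exists k', s k' = K by apply; exact: (sge K.+1).
elim=> [|k IH].
  by rewrite ltnNge; have [_ _ ->] := nxP 0%N.
case: (ltngtP (s k) K) => [kK|/IH//|]; last by exists k.
by rewrite ltnNge smin.
Qed.

(** * Linear independence over the rationals *)

(** Multiplying a rational relation by all its denominators gives an integer one. *)
Lemma no_zero_Q_lin_indep (R : realType) (r : nat) (alpha : 'rV[R]_r) :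
  (forall n, nonzero_pt n -> zeta alpha n <> 0) -> Q_lin_indep_1 alpha.
Proof.
move=> nz q q0 j; apply/eqP/negPn/negP => qj.
pose n (j : 'I_r.+1) := numq (q j) * \prod_(i | i != j) denq (q i).
have nE i : (n i)%:~R = ratr (q i) * (\prod_i denq (q i))%:~R :> R.
  rewrite /n [in RHS](bigD1 i) //= !intrM mulrA; congr (_ * _).
  by rewrite /ratr divfK // intr_eq0 denq_neq0.
apply: (nz n).
  exists j; rewrite mulf_neq0 ?numq_eq0 //.
  by apply/prodf_neq0 => i _; exact: denq_neq0.
apply/eqP; rewrite /zeta normr_eq0; apply/eqP.
under eq_bigr do rewrite nE mulrAC.
by rewrite nE -mulr_suml -mulrDl q0 mul0r.
Qed.

Lemma Q_lin_indep_irrational (R : realType) (r : nat) (alpha : 'rV[R]_r) (i : 'I_r) :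
  Q_lin_indep_1 alpha -> forall a q : nat, alpha 0 i <> a%:R / q%:R.
Proof.
move=> indep a q E.
pose c (j : 'I_r.+1) : rat :=
  if unlift ord0 j is Some l then (if l == i then 1 else 0) else - (a%:R / q%:R).
suff: 1 = 0 :> rat by move/eqP; rewrite oner_eq0.
have := indep c _ (lift ord0 i); rewrite /c liftK eqxx; apply.
rewrite unlift_none (bigD1 i) //= big1 => [|l /negPf li].
  by rewrite liftK eqxx rmorphN rmorph1 fmorph_div !rmorph_nat E mul1r addr0 addNr.
by rewrite liftK li rmorph0 mul0r.
Qed.

(** * From the leading forms to all best approximations *)

Lemma leading_forms_spec (R : realType) (r : nat) (alpha : 'rV[R]_r.+1)
    (phi : nat -> R) (Q : nat -> nat) (v : nat -> 'I_r.+2 -> int) :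
  (0 < r)%N -> (forall m n, (0 < m <= n)%N -> phi n <= phi m) ->
  Q 0%N = 1%N -> (forall k, (Q k < Q k.+1)%N) ->
  (forall k, nonzero_pt (v k) /\ supnorm (v k) = Q k) ->
  (forall k, zeta alpha (v k) <= phi (Q (k + r)%N) /\
     forall n, nonzero_pt n -> (supnorm n < Q k)%N ->
       zeta alpha (v k) < zeta alpha n) ->
  Q_lin_indep_1 alpha /\
  exists Mseq : nat -> nat, enum_best_norms alpha Mseq /\
    forall (nu : nat) (m : 'I_r.+2 -> int),
      best_approx alpha m -> supnorm m = Mseq nu ->
      zeta alpha m <= phi (Mseq (nu + r)%N).
Proof.
move=> r0 phile Q0 QS vP zP.
have Qge k : (k <= Q k)%N by elim: k => // k IH; exact: leq_ltn_trans (QS k).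
split.
  (* A zero at [n] would be strictly undercut by a leading form of larger norm. *)
  apply: no_zero_Q_lin_indep => n n0 zn0.
  have [_ /(_ n n0 (Qge _))] := zP (supnorm n).+1.
  by rewrite zn0 ltNge normr_ge0.
pose B K := exists m, best_approx alpha m /\ supnorm m = K.
have BQ k : B (Q k).
  have [v0 vQ] := vP k; have [_ vmin] := zP k.
  (* A minimiser in the box of size [Q k] has norm exactly [Q k], since [v k] strictly beats all
     shorter points. *)
  have [|m [m0 mK mmin]] := exists_best_le R r.+1 alpha (Q k).
    by rewrite -vQ supnorm_gt0.
  have mQ : supnorm m = Q k.
    apply/eqP; rewrite eqn_leq mK leqNgt; apply/negP => /(vmin _ m0).
    by rewrite ltNge mmin // vQ.
  by exists m; split=> //; split=> // n n0; rewrite mQ; exact: mmin.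
have [|s [sS sB smin]] := enum_unbounded B.
  by move=> N; exists (Q N).
exists s; split=> // nu m [m0 mbest] mnu.
have [k /andP[Qk kQ]] : exists k, (Q k <= supnorm m < Q k.+1)%N.
  suff: forall k, (supnorm m < Q k)%N -> exists k, (Q k <= supnorm m < Q k.+1)%N.
    by apply; exact: Qge (supnorm m).+1.
  elim=> [|k IH]; first by rewrite Q0 ltnS leqn0 eqn0Ngt supnorm_gt0.
  by case: (leqP (Q k) (supnorm m)) => [Qm mQ|/IH//]; exists k; rewrite Qm.
have [v0 vQ] := vP k; have [zv _] := zP k.
(* Every [Q] value is a term of [s], so one step of [s] cannot jump past the next [Q]. *)
have slt i : (s (nu + i) < Q (k + i).+1)%N.
  elim: i => [|i IH]; first by rewrite !addn0 -mnu.
  by rewrite !addnS; apply: leq_ltn_trans (QS _); exact: smin.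
apply: le_trans (mbest _ v0 _) _; first by rewrite vQ.
(* Taking [i = r.-1] and one more step of [s] gives [s (nu + r) <= Q (k + r)]. *)
apply: le_trans zv (phile _ _ _); rewrite -(prednK r0) !addnS.
by rewrite (leq_ltn_trans _ (sS _)) //=; exact: smin (slt _).
Qed.

(** * Positivity of [psi] and uncountability *)

(** The limit 0 is at most [psi (x + 1)], which is strictly below [psi x]. *)
Lemma decreasing_to0_gt0 (R : realType) (psi : R -> R) :
  (forall x y : R, 1 <= x -> x < y -> psi y < psi x) ->
  psi x @[x --> +oo] --> 0 -> forall x, 1 <= x -> 0 < psi x.
Proof.
move=> psilt psi0 x x1.
have x1lt : x < x + 1 by rewrite ltrDl.
apply: le_lt_trans (psilt _ _ x1 x1lt).
apply: (cvgr_to_le psi0); near=> y; apply: ltW; apply: psilt.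
  by apply: le_trans x1 (ltW _).
by near: y; apply: nbhs_pinfty_gt; exact: num_real.
Unshelve. all: by end_near.
Qed.

Theorem theorem1p4 (R : realType) (r : nat) (psi : R -> R) :
  (2 <= r)%N ->
  (forall x y : R, 1 <= x -> x < y -> psi y < psi x) ->
  psi x @[x --> +oo] --> 0 ->
  exists S : set 'rV[R]_r,
    ~ countable S /\
    forall alpha, S alpha ->
      Q_lin_indep_1 alpha /\
      exists Mseq : nat -> nat,
        enum_best_norms alpha Mseq /\
        forall (nu : nat) (m : 'I_r.+1 -> int),
          best_approx alpha m -> supnorm m = Mseq nu ->
          zeta alpha m <= psi (Mseq (nu + r - 1)%N)%:R.
Proof.
case: r => [//|r] r1 psilt psi0.
have psigt0 := decreasing_to0_gt0 R psi psilt psi0.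
pose phi n := psi n%:R.
have phi0 n : (0 < n)%N -> 0 < phi n by move=> n0; rewrite psigt0 // ler1n.
have phile m n : (0 < m <= n)%N -> phi n <= phi m.
  move=> /andP[m0]; rewrite leq_eqVlt => /predU1P[->//|mn].
  by apply/ltW/psilt; rewrite ?ler1n ?ltr_nat.
pose good (alpha : 'rV[R]_r.+1) := Q_lin_indep_1 alpha /\
  exists Mseq : nat -> nat, enum_best_norms alpha Mseq /\
    forall (nu : nat) (m : 'I_r.+2 -> int),
      best_approx alpha m -> supnorm m = Mseq nu ->
      zeta alpha m <= psi (Mseq (nu + r.+1 - 1)%N)%:R.
exists [set alpha | good alpha]; split=> // /countable_injP[f finj].
(* [b] inverts the injection [f], with default 0 at indices not attained. *)
have [b bP] : {b : nat -> 'rV[R]_r.+1 &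
    forall k alpha, good alpha -> f alpha = k -> b k = alpha}.
  apply: (@choice nat 'rV[R]_r.+1
    (fun k beta => forall alpha, good alpha -> f alpha = k -> beta = alpha)) => k.
  have [[beta [gb fb]]|no] := pselect (exists beta, good beta /\ f beta = k).
    exists beta => alpha ga fa; apply: finj; rewrite ?inE //.
    by rewrite fb fa.
  by exists 0 => alpha ga fa; case: no; exists alpha.
have [alpha [Q [v [Q0 QS vP zP avoid]]]] :=
  exists_leading_forms R r phi (fun k => b k 0 0) r1 phi0 phile.
have galpha : good alpha.
  have [indep [s [sE sle]]] := leading_forms_spec R r alpha phi Q v r1 phile Q0 QS vP zP.
  split=> //; exists s; split=> // nu m mb ms.
  by rewrite addnS subn1 /=; exact: sle.
(* The new [alpha] is itself listed by [b], at index [f alpha], and its first coordinate is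
   irrational, so it had to be avoided. *)
apply: (avoid (f alpha)); rewrite (bP _ alpha galpha) //.
exact: Q_lin_indep_irrational galpha.1.
Qed.
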